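(* Let $G$ be a finite simple undirected graph with $m$ edges in which every vertex has degree at least $2$, and let $\chi(u,0)=\det(\mathbf{T}+u\mathbf{J})=d_0u^{2m}+d_1u^{2m-1}+\cdots+d_{2m}$ be its reduced Bartholdi zeta function. Then $d_0=(-1)^m$ and $d_1=0$.
   Context: Symmetric digraph: $\mathcal{D}(G)$ has vertex set $V(G)$ and arc set $\mathcal{E}(G)=\{(x,y),(y,x): xy\in E(G)\}$. For an arc $a=(x,y)$, $o(a)=x$, $t(a)=y$, $a^{-1}=(y,x)$. Label the $2m$ arcs $a_1,\dots,a_m,a_{m+1}=a_1^{-1},\dots,a_{2m}=a_m^{-1}$ (for an arbitrary orientation of the edges). The $2m\times2m$ matrices are: $\mathbf{T}_{ij}=1$ if $t(a_i)=o(a_j)$ and $a_j\ne a_i^{-1}$, and $0$ otherwise; $\mathbf{J}_{ij}=1$ if $a_j=a_i^{-1}$, and $0$ otherwise. *)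

(* Defs.v *)
From HB Require Import structures.
From mathcomp Require Import all_boot all_order all_algebra.

Set Implicit Arguments.
Unset Strict Implicit.
Unset Printing Implicit Defensive.

Import GRing.Theory.
Local Open Scope ring_scope.

Record sgraph := SGraph {
  vertex :> finType;
  adj : rel vertex;
  adj_sym : symmetric adj;
  adj_irrefl : irreflexive adj
}.

Section SymmetricDigraph.
Variable G : sgraph.

Definition degree (x : G) : nat := #|[set y : G | adj x y]|.

Definition edges : {set {set G}} :=
  [set A : {set G} |
    [exists x : G, exists y : G, adj x y && (A == [set x; y])]].

Definition arc : Type := {a : G * G | adj a.1 a.2}.

Definition origin (a : arc) : G := (val a).1.

Definition terminus (a : arc) : G := (val a).2.

Lemma arc_inv_subproof (a : arc) : adj (terminus a) (origin a).
Proof. by rewrite adj_sym; exact: (valP a). Qed.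

Definition arc_inv (a : arc) : arc :=
  exist (fun p : G * G => adj p.1 p.2) (terminus a, origin a)
        (arc_inv_subproof a).

(* The arcs a_1, ..., a_m are the lshift indices, their inverses
   a_(m+1), ..., a_(2m) the rshift ones; bijectivity makes a_1, ..., a_m an
   orientation of the edges. *)
Record arc_labelling := ArcLabelling {
  label :> 'I_(#|edges| + #|edges|) -> arc;
  label_bij : bijective label;
  label_inv : forall i : 'I_#|edges|,
    label (rshift #|edges| i) = arc_inv (label (lshift #|edges| i))
}.

Variable a : arc_labelling.

Definition Tmx : 'M[int]_(#|edges| + #|edges|) :=
  \matrix_(i, j)
    (if (terminus (a i) == origin (a j)) && (a j != arc_inv (a i))
     then 1 else 0).

Definition Jmx : 'M[int]_(#|edges| + #|edges|) :=
  \matrix_(i, j) (if a j == arc_inv (a i) then 1 else 0).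

(* chi(u, 0), as a polynomial in the indeterminate u. *)
Definition reduced_bartholdi : {poly int} :=
  \det (map_mx polyC Tmx + 'X *: map_mx polyC Jmx).

(* Coefficients are numbered from the top formal degree 2m downwards. The
   subtraction is truncated, so this is d_k only for k <= 2m. *)
Definition bartholdi_coef (k : nat) : int :=
  reduced_bartholdi`_(2 * #|edges| - k).

End SymmetricDigraph.

(* Main.v *)
Require Import Defs.
From HB Require Import structures.
From mathcomp Require Import all_boot all_order all_algebra.

(** The labelling lists an orientation of the edges and then the inverse arcs in
    the same order, so [J] is the block matrix [0 1; 1 0]: it satisfies
    [J^2 = 1] and [\det J = (-1)^m].  Hence [T + u J = (u - (- T J)) J], and the
    reduced Bartholdi zeta function is [(-1)^m] times the characteristic
    polynomial of [- T J] (lemma [reduced_bartholdi_char_poly]).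

    That polynomial is monic of degree [2 m], which gives [d_0].  Its next
    coefficient is [\tr (T J)], the sum of all [T_ij * J_ji]; it vanishes
    because [T] excludes the backtracking pairs, on which [J] is supported
    (lemma [mxtrace_Tmx_Jmx]).  A vertex of positive degree provides an edge, so
    that [m > 0] and the index [2 m - 1] of [d_1] is not truncated. *)

Set Implicit Arguments.
Unset Strict Implicit.
Unset Printing Implicit Defensive.

Import GRing.Theory.
Local Open Scope ring_scope.

(** Two block transvections turn the swap matrix into [1 1; 0 -1]. *)
Lemma det_block_swap (R : comNzRingType) (n : nat) :
  \det (block_mx 0 1%:M 1%:M 0 : 'M[R]_(n + n)) = (-1) ^+ n.
Proof.
have reduce : block_mx 1%:M 0 (- 1%:M) 1%:M *m
    ((block_mx 0 1%:M 1%:M 0 : 'M[R]_(n + n)) *m block_mx 1%:M 0 1%:M 1%:M)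
  = block_mx 1%:M 1%:M 0 (- 1%:M).
  rewrite !mulmx_block !(mul0mx, mul1mx, mulmx0, mulmx1, addr0, add0r).
  by rewrite addNr.
have := congr1 determinant reduce.
rewrite !det_mulmx !det_lblock det_ublock !det1 !mulr1 !mul1r => ->.
by rewrite -scaleN1r detZ det1 mulr1.
Qed.

Section ReducedBartholdi.

Variables (G : sgraph) (a : arc_labelling G).

Lemma arc_invK : involutive (@arc_inv G).
Proof. by move=> b; apply: val_inj; case: b => [[x y] ?]. Qed.

Lemma Jmx_block : Jmx a = block_mx 0 1%:M 1%:M 0.
Proof.
have label_inj := bij_inj (label_bij a).
apply/matrixP=> i j; rewrite -[i]splitK -[j]splitK.
case: (split i) => i'; case: (split j) => j' /=.
- by rewrite block_mxEul !mxE -label_inv (inj_eq label_inj) eq_lrshift.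
- rewrite block_mxEur !mxE -label_inv (inj_eq label_inj) eq_rshift eq_sym.
  by case: eqP.
- rewrite block_mxEdl !mxE label_inv arc_invK (inj_eq label_inj) eq_lshift.
  by rewrite eq_sym; case: eqP.
- by rewrite block_mxEdr !mxE (label_inv _ i') arc_invK (inj_eq label_inj)
    eq_rlshift.
Qed.

Lemma mulmx_Jmx_Jmx : Jmx a *m Jmx a = 1%:M.
Proof.
rewrite Jmx_block mulmx_block !(mul0mx, mul1mx, mulmx0, addr0, add0r).
by rewrite -scalar_mx_block.
Qed.

(** A term [T_ij * J_ji] needs [a_i] to be the inverse of [a_j] for its second
    factor, which is what kills the first one. *)
Lemma mxtrace_Tmx_Jmx : \tr (Tmx a *m Jmx a) = 0.
Proof.
rewrite /mxtrace big1 // => i _; rewrite mxE big1 // => j _; rewrite !mxE.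
case: (a i =P _) => [->|_]; last by rewrite mulr0.
by rewrite arc_invK eqxx andbF mul0r.
Qed.

Lemma reduced_bartholdi_char_poly :
  reduced_bartholdi a =
    char_poly (- (Tmx a *m Jmx a)) * ((-1) ^+ #|edges G|)%:P.
Proof.
rewrite /reduced_bartholdi -(@det_block_swap int) -Jmx_block -det_map_mx.
rewrite /char_poly -det_mulmx; congr (\det _).
rewrite /char_poly_mx map_mxN opprK mulmxDl mul_scalar_mx -map_mxM -mulmxA.
by rewrite mulmx_Jmx_Jmx mulmx1 addrC.
Qed.

End ReducedBartholdi.

Lemma edges_gt0 (G : sgraph) (x : G) : (0 < degree x)%N -> (0 < #|edges G|)%N.
Proof.
case/card_gt0P=> y; rewrite inE => xy; apply/card_gt0P; exists [set x; y].
by rewrite inE; apply/existsP; exists x; apply/existsP; exists y; rewrite xy /=.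
Qed.

Theorem lemma4p1 (G : sgraph) (G_nonempty : (0 < #|G|)%N)
  (G_mindeg : forall x : G, (2 <= degree x)%N) (a : arc_labelling G) :
  bartholdi_coef a 0 = (-1) ^+ #|edges G| /\ bartholdi_coef a 1 = 0.
Proof.
have [x _] := card_gt0P G_nonempty.
have m_gt0 : (0 < #|edges G| + #|edges G|)%N.
  by rewrite addn_gt0 (edges_gt0 (ltnW (G_mindeg x))).
rewrite /bartholdi_coef reduced_bartholdi_char_poly !coefMC mul2n -addnn.
split; last first.
  by rewrite subn1 char_poly_trace // raddfN /= mxtrace_Tmx_Jmx !oppr0 mul0r.
have := char_poly_monic (- (Tmx a *m Jmx a)).
by rewrite monicE lead_coefE size_char_poly subn0 => /eqP ->; rewrite mul1r.
Qed.
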